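(* For every integer $k\geq 3$ there are positive constants $c=c(k)$ and $c'=c'(k)$ such that $$2^{c'n^{k-2}\log n}\;\geq\; r_k(k+1,3;n)\;\geq\; 2^{c\,n^{k-2}}.$$
   Context: A $k$-uniform hypergraph ($k$-graph) is a collection of $k$-element subsets (edges) of a vertex set; $K^k_N$ denotes the complete $k$-graph on $N$ vertices. For integers $2\le k<s<n$ and $2\le t\le\binom{s}{k}$, $r_k(s,t;n)$ denotes the minimum $N$ such that every red/blue coloring of the edges of $K^k_N$ yields either an $n$-vertex set all of whose $k$-subsets are blue, or a set of $s$ vertices containing at least $t$ red $k$-subsets. *)

(* Defs.v *)
From mathcomp Require Import all_boot.
From mathcomp Require Import boolp.
Set Implicit Arguments.
Unset Strict Implicit.
Unset Printing Implicit Defensive.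

Section HypergraphRamsey.
Variables (k s t n : nat).

Section Coloring.
Variable N : nat.

Definition edge (e : {set 'I_N}) : bool := #|e| == k.

(* A red/blue coloring of the edges of K^k_N: [f e] is true when e is red.
   The values of f on sets that are not edges are never used. *)
Definition coloring := {ffun {set 'I_N} -> bool}.

Definition red_edges_in (f : coloring) (S : {set 'I_N}) : {set {set 'I_N}} :=
  [set e : {set 'I_N} | [&& e \subset S, edge e & f e]].

Definition has_blue_clique (f : coloring) : bool :=
  [exists S : {set 'I_N}, (#|S| == n) &&
     [forall e : {set 'I_N}, (e \subset S) && edge e ==> ~~ f e]].

Definition has_red_spot (f : coloring) : bool :=
  [exists S : {set 'I_N}, (#|S| == s) && (t <= #|red_edges_in f S|)].

End Coloring.

Definition ramsey_arrow (N : nat) : bool :=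
  [forall f : coloring N, has_blue_clique f || has_red_spot f].

(* r_k(s, t; n), the least N with [ramsey_arrow N]; the junk value 0 is taken
   if there is no such N, so a positive lower bound entails existence. *)
Definition ramsey_number : nat :=
  if pselect (exists N, ramsey_arrow N) is left exN then ex_minn exN else 0.

End HypergraphRamsey.

(* Main.v *)
(* Upper bound. Grow a blue clique S against a reservoir W in which every vertex
   forms only blue edges with the (k-1)-subsets of S. Pick v in W. If for some
   (k-2)-subset d of S the set R of those w in W with d + v + w red is a sizeable
   fraction of W, replace W by R: since a (k+1)-set contains at most two red
   edges, all edges d + w + w' with w, w' in R are then blue, so d never has to
   be considered again, and this happens at most C(n, k-2) times. Otherwise
   move v to S and delete all these sets R from W. Hence a reservoir of
   (C(n, k-2) + 2) ^ (n + C(n, k-2)) vertices suffices.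

   Lower bound. Orient every (k-1)-set at random and colour a k-set red when the
   orientations of its facets agree with one of its two orientations (for k = 3:
   cyclic triangles of a random tournament). At most two facets of a (k+1)-set
   are red. Every n-set contains of order n^(k-1) k-subsets without common
   facets, and these are red independently with constant probability, so that a
   given n-set is a blue clique with probability exp(- c n^(k-1)); a union bound
   over the at most N^n such sets gives N >= exp(c n^(k-2)). *)
Require Import Defs.
From mathcomp Require Import all_boot all_order all_algebra.
From mathcomp Require Import boolp reals exp.
From mathcomp Require Import zify ring lra.
Set Implicit Arguments.
Unset Strict Implicit.
Unset Printing Implicit Defensive.

Lemma ffact_le_exp n k : n ^_ k <= n ^ k.
Proof.
rewrite ffact_prod -[k in n ^ k]card_ord -prod_nat_const.
by apply: leq_prod => i _; apply: leq_subr.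
Qed.

Lemma bin_le_exp n k : 'C(n, k) <= n ^ k.
Proof.
by apply: leq_trans (ffact_le_exp n k); rewrite -bin_ffact leq_pmulr ?fact_gt0.
Qed.

Lemma exp_le_bin n k : k <= n -> n ^ k <= 'C(n, k) * k ^ k.
Proof.
move=> le_kn; rewrite -(leq_pmul2r (fact_gt0 k)) mulnAC bin_ffact -ffactnn.
have expE m : m ^ k = \prod_(i < k) m by rewrite prod_nat_const card_ord.
rewrite !ffact_prod !expE -!big_split /=.
by apply: leq_prod => i _; rewrite mulnBr mulnBl leq_sub2l // mulnC leq_mul2r le_kn orbT.
Qed.

Lemma ramsey_arrow_number k s t n N :
  ramsey_arrow k s t n N -> ramsey_arrow k s t n (ramsey_number k s t n).
Proof.
move=> arr; rewrite /ramsey_number; case: pselect => [ex | []]; last by exists N.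
by case: ex_minnP.
Qed.

Lemma ramsey_number_le k s t n N : ramsey_arrow k s t n N -> ramsey_number k s t n <= N.
Proof.
move=> arr; rewrite /ramsey_number; case: pselect => [ex | []]; last by exists N.
by case: ex_minnP => m _; apply.
Qed.

Section FiniteSets.
Variables X I J : finType.
Implicit Types (T V W : {set X}) (D : {set I}).

Lemma leq_card_bigcup (P : pred I) (B : I -> {set X}) :
  #|\bigcup_(i | P i) B i| <= \sum_(i | P i) #|B i|.
Proof.
elim/big_rec2: _ => [|i m V _ le]; first by rewrite cards0.
by apply: leq_trans (leq_card_setU _ _) _; rewrite leq_add2l.
Qed.

Lemma exists_large_fiber (j0 : J) D (p : I -> J) :
  exists j, #|D| <= #|J| * #|[set i in D | p i == j]|.
Proof.
pose fiber j := #|[set i in D | p i == j]|.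
exists [arg max_(j > j0) fiber j]; case: arg_maxnP => // j _ maxj.
rewrite -sum1_card (partition_big p predT) //= -sum_nat_const.
apply: leq_sum => j' _; apply: leq_trans (maxj j' isT).
by rewrite sum1_card /fiber cardsE.
Qed.

Lemma setD2_split V W v : v \in W :\: V -> #|W :\: V| = 2 ->
  exists2 w, w \in (W :\: V) :\ v & W = w |: (v |: W :&: V).
Proof.
move=> vWV c2; have /cards1P[w Ew] : #|(W :\: V) :\ v| == 1.
  by have := cardsD1 v (W :\: V); rewrite vWV c2 => -[/esym/eqP].
exists w; first by rewrite Ew set11.
by rewrite setUCA setUA -Ew setD1K // setUC setID.
Qed.

Definition ksubsets k V : {set {set X}} := [set T : {set X} | T \subset V & #|T| == k].

Lemma ksubsetsP k V T : reflect (T \subset V /\ #|T| = k) (T \in ksubsets k V).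
Proof. by rewrite inE; apply: (iffP andP) => -[? /eqP]. Qed.

Lemma card_ksubsets k V : #|ksubsets k V| = 'C(#|V|, k).
Proof. exact: cards_draws. Qed.

Lemma ksubsetsS k V W : V \subset W -> ksubsets k V \subset ksubsets k W.
Proof.
move=> sVW; apply/subsetP => T /ksubsetsP[sTV cT].
by apply/ksubsetsP; split=> //; apply: subset_trans sTV sVW.
Qed.

Definition facets V : {set {set X}} := [set V :\ v | v in V].

Lemma setD1_inj V : {in V &, injective (fun v => V :\ v)}.
Proof.
move=> v w vV _ /setP/(_ v); rewrite !inE eqxx vV /= andbT.
by move=> /esym/negbFE/eqP.
Qed.

Lemma card_facets V : #|facets V| = #|V|.
Proof. exact/card_in_imset/setD1_inj. Qed.

Lemma facets_ksubsets k V : #|V| = k.+1 -> facets V = ksubsets k V.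
Proof.
move=> cV; apply/eqP; rewrite eqEcard card_facets card_ksubsets cV binSn leqnn andbT.
apply/subsetP => _ /imsetP[v vV ->]; apply/ksubsetsP; split; first exact: subsetDl.
by have := cardsD1 v V; rewrite vV cV => -[].
Qed.

End FiniteSets.

Lemma card_red_edges_in k N (f : coloring N) (V : {set 'I_N}) : #|V| = k.+1 ->
  #|red_edges_in k f V| = #|[set v in V | f (V :\ v)]|.
Proof.
move=> cV; have -> : red_edges_in k f V = [set V :\ v | v in [set v in V | f (V :\ v)]].
  apply/setP => e; apply/idP/imsetP => [|[v /setIdP[vV fv] ->]].
    rewrite inE => /and3P[sV ek fe].
    have : e \in facets V by rewrite (facets_ksubsets cV) inE sV.
    by case/imsetP => v vV E; exists v; rewrite // inE vV -E.
  have : V :\ v \in facets V by apply: imset_f.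
  by rewrite (facets_ksubsets cV) !inE /edge fv andbT.
by rewrite card_in_imset // => v w /setIdP[vV _] /setIdP[wV _]; apply: setD1_inj.
Qed.

Lemma has_red_spotP k t N (f : coloring N) :
  reflect (exists2 V : {set 'I_N}, #|V| = k.+1 & t <= #|[set v in V | f (V :\ v)]|)
          (has_red_spot k k.+1 t f).
Proof.
apply: (iffP existsP) => -[V].
  by case/andP=> /eqP cV; rewrite card_red_edges_in //; exists V.
by move=> cV le; exists V; rewrite cV eqxx card_red_edges_in.
Qed.

Section Reservoir.
Variables (N k n : nat) (f : coloring N).
Implicit Types (S W V d e : {set 'I_N}) (D : {set {set 'I_N}}).

Definition red_link W d v := [set w in W :\ v | f (w |: (v |: d))].

(* The second alternative of the last clause concerns the edges [w |: (w' |: d)] with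
   [d] in [D] and [w], [w'] in [W]. *)
Definition reservoir S W D : Prop :=
  [/\ [disjoint S & W], D \subset ksubsets k S &
     {in ksubsets k.+2 (S :|: W), forall e,
       (#|e :\: S| <= 1) || (e :&: S \in D) -> ~~ f e}].

Lemma red_link_sub W d v : red_link W d v \subset W.
Proof. by apply/subsetP => w /setIdP[/setD1P[]]. Qed.

Lemma reservoir_blue_clique S W D :
  reservoir S W D -> #|S| = n -> has_blue_clique k.+2 n f.
Proof.
case=> _ _ blue cS; apply/existsP; exists S; rewrite cS eqxx.
apply/forall_inP => e /andP[sS ek]; apply: blue.
  by apply/ksubsetsP; split; [apply: subset_trans sS (subsetUl S W) | apply/eqP].
by move: sS; rewrite -setD_eq0 => /eqP->; rewrite cards0.
Qed.

Hypothesis no_red_spot : ~~ has_red_spot k.+2 k.+3 3 f.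

(* At most two facets of [v |: (w |: (w' |: d))] are red, and removing [w'] or [w]
   already produces two. *)
Lemma red_link_blue W d v w w' : #|d| = k -> v \notin d -> [disjoint d & W] ->
    w \in red_link W d v -> w' \in red_link W d v -> w != w' ->
  ~~ f (w |: (w' |: d)).
Proof.
move=> cd vd dW /setIdP[/setD1P[wv wW] fw] /setIdP[/setD1P[w'v w'W] fw'] ww'.
have wd : w \notin d by rewrite (disjointFl dW wW).
have w'd : w' \notin d by rewrite (disjointFl dW w'W).
apply: contra no_red_spot => fww'; apply/has_red_spotP; exists (v |: (w |: (w' |: d))).
  by rewrite !cardsU1 !inE !negb_or vd wd w'd ww' ![v == _]eq_sym wv w'v cd.
apply/card_gt2P; exists v, w, w'; split; last by rewrite eq_sym wv ww' w'v.
split; rewrite !inE !eqxx ?orbT /=.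
- by rewrite setU1K // !inE !negb_or vd ![v == _]eq_sym wv w'v.
- rewrite [v |: _]setUCA setU1K; first by rewrite setUCA.
  by rewrite !inE !negb_or wv ww' wd.
- rewrite [w |: _]setUCA [v |: _]setUCA setU1K; first by rewrite setUCA.
  by rewrite !inE !negb_or w'v eq_sym ww' w'd.
Qed.

Lemma reservoir_complete S W D d v :
    reservoir S W D -> v \in W -> d \in ksubsets k S ->
  reservoir S (red_link W d v) (d |: D).
Proof.
move=> [dSW sD blue] vW dk; have /ksubsetsP[dS cd] := dk.
split; first exact: disjointWr (red_link_sub W d v) dSW.
  by rewrite subUset sub1set dk.
move=> e eR; have /ksubsetsP[sR ce] := eR.
have eW : e \in ksubsets k.+2 (S :|: W).
  exact: subsetP (ksubsetsS _ (setUS S (red_link_sub W d v))) e eR.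
have [ed _ | ned] := eqVneq (e :&: S) d; last first.
  by rewrite in_setU1 (negPf ned) /=; apply: blue.
have c2 : #|e :\: S| = 2 by have := cardsID S e; rewrite ed cd ce; lia.
have /card_gt0P[w' w'eS] : 0 < #|e :\: S| by rewrite c2.
have [w /setD1P[ww' weS] ->] := setD2_split w'eS c2; rewrite ed.
have inR u : u \in e :\: S -> u \in red_link W d v.
  by case/setDP => /(subsetP sR)/setUP[->|].
have dW : [disjoint d & W] by apply: disjointWl dS dSW.
have vd : v \notin d by rewrite (disjointFl dW vW).
exact: (red_link_blue cd vd dW (inR w weS) (inR w' w'eS) ww').
Qed.

Lemma edge_through_blue S W D v e : reservoir S W D -> v \in W ->
    e \in ksubsets k.+2 (S :|: W) -> v \in e -> #|e :\: (v |: S)| <= 1 ->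
    (forall w, w \in e :\: (v |: S) -> e :&: S \in ksubsets k S :\: D ->
       w \notin red_link W (e :&: S) v) ->
  ~~ f e.
Proof.
move=> [dSW _ blue] vW eW ve; rewrite setUC -setDDl => le1 notlink.
have /ksubsetsP[sSW ce] := eW.
have [le1S | gt1S] := leqP #|e :\: S| 1; first by apply: blue; rewrite ?le1S.
have [eD | eD] := boolP (e :&: S \in D); first by apply: blue; rewrite ?eD ?orbT.
have veS : v \in e :\: S by rewrite inE ve (disjointFl dSW vW).
have c2 : #|e :\: S| = 2 by have := cardsD1 v (e :\: S); rewrite veS; lia.
have dk : e :&: S \in ksubsets k S :\: D.
  rewrite inE eD; apply/ksubsetsP; split; first exact: subsetIr.
  by have := cardsID S e; rewrite c2 ce addn2 => -[].
have [w weSv eE] := setD2_split veS c2.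
have /setD1P[wv /setDP[we wS]] := weSv.
have wW : w \in W by have /setUP[|//] := subsetP sSW w we; rewrite (negPf wS).
by apply: contra (notlink w weSv dk) => fe; rewrite !inE wv wW -eE.
Qed.

Lemma reservoir_absorb S W D v : reservoir S W D -> v \in W ->
  reservoir (v |: S)
    ((W :\ v) :\: \bigcup_(d in ksubsets k S :\: D) red_link W d v) D.
Proof.
move=> resS vW; have [dSW sD blue] := resS; set W' := _ :\: _.
have sW'W : W' \subset W by apply: subset_trans (subsetDl _ _) (subsetDl _ _).
split.
- rewrite disjoints_subset subUset sub1set -disjoints_subset.
  by rewrite (disjointWr sW'W dSW) !inE eqxx andbF.
- exact: subset_trans sD (ksubsetsS k (subsetUr [set v] S)).
move=> e /ksubsetsP[sSW' ce].
have eW : e \in ksubsets k.+2 (S :|: W).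
  apply/ksubsetsP; split=> //; apply: subset_trans sSW' _.
  by rewrite !subUset subsetUl sub1set inE vW orbT (subset_trans sW'W (subsetUr S W)).
have [ve | ve] := boolP (v \in e); last first.
  have ev : [disjoint e & [set v]] by rewrite disjoint_sym disjoints1.
  by rewrite setIUr -setDDl (disjoint_setI0 ev) set0U (setDidPl ev); apply: blue.
have vD : e :&: (v |: S) \notin D.
  apply: contraL vW => /(subsetP sD)/ksubsetsP[/subsetP sS _].
  by rewrite (disjointFr dSW) // sS // !inE ve eqxx.
rewrite (negPf vD) orbF => le1; apply: (edge_through_blue resS vW eW ve le1).
move=> w /setDP[we wvS] dk; have /setUP[|/setDP[_ wU]] := subsetP sSW' w we.
  by rewrite (negPf wvS).
by apply: contra wU => wR; apply/bigcupP; exists (e :&: S).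
Qed.

Lemma reservoir_step S W D m : 0 < m -> reservoir S W D -> #|S| < n ->
    ('C(n, k) + 2) * m <= #|W| ->
  exists S' W' D', [/\ reservoir S' W' D', #|S'| <= n,
    #|S'| + #|D'| = (#|S| + #|D|).+1 & m <= #|W'|].
Proof.
move=> m_gt0 resS ltSn leW; have [dSW _ _] := resS.
have /card_gt0P[v vW] : 0 < #|W| by apply: leq_trans leW; rewrite muln_gt0 m_gt0 addn2.
have [/exists_inP[d /setDP[dk dD] large] | small] :=
    boolP [exists d in ksubsets k S :\: D, m <= #|red_link W d v|].
  exists S, (red_link W d v), (d |: D); split=> //; last by rewrite cardsU1 dD addnS.
    exact: reservoir_complete.
  exact: ltnW.
set U := \bigcup_(d in ksubsets k S :\: D) red_link W d v.
exists (v |: S), ((W :\ v) :\: U), D; split.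
- exact: reservoir_absorb.
- by rewrite cardsU1 (disjointFl dSW vW).
- by rewrite cardsU1 (disjointFl dSW vW).
have leU : #|U| <= 'C(n, k) * m.
  apply: leq_trans (leq_card_bigcup _ _) _.
  apply: (@leq_trans (\sum_(d in ksubsets k S :\: D) m)).
    apply: leq_sum => d dSD; apply: ltnW.
    by have /exists_inPn/(_ d dSD) := small; rewrite -ltnNge.
  rewrite sum_nat_const leq_mul2r; apply/orP; right.
  apply: leq_trans (subset_leq_card (subsetDl _ _)) _.
  by rewrite card_ksubsets leq_bin2l // ltnW.
have leWU : #|W| <= #|W :\ v :\: U| + #|U| + 1.
  rewrite (cardsD1 v W) vW addnC leq_add2r -(cardsID U (W :\ v)) addnC leq_add2l.
  by rewrite subset_leq_card ?subsetIr.
lia.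
Qed.

Lemma blue_clique_of_reservoir S W D j :
    reservoir S W D -> #|S| <= n -> n + 'C(n, k) <= #|S| + #|D| + j ->
    ('C(n, k) + 2) ^ j <= #|W| ->
  has_blue_clique k.+2 n f.
Proof.
elim: j S W D => [|j IH] S W D resS leS lej leW.
  apply: (reservoir_blue_clique resS); have [_ /subset_leq_card leD _] := resS.
  by have := leq_bin2l k leS; rewrite card_ksubsets in leD; lia.
have [eqS | neS] := eqVneq #|S| n; first exact: (reservoir_blue_clique resS eqS).
have ltS : #|S| < n by rewrite ltn_neqAle neS.
have size_gt0 : 0 < ('C(n, k) + 2) ^ j by rewrite expn_gt0 addn2.
rewrite expnS in leW.
have [S' [W' [D' [resS' leS' cSD leW']]]] := reservoir_step size_gt0 resS ltS leW.
by apply: (IH S' W' D') => //; lia.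
Qed.

End Reservoir.

Lemma ramsey_arrow_upper k n :
  ramsey_arrow k.+2 k.+3 3 n (('C(n, k) + 2) ^ (n + 'C(n, k))).
Proof.
apply/forallP => f; rewrite orbC; have [//|nred /=] := boolP (has_red_spot _ _ _ f).
apply: (blue_clique_of_reservoir nred (S := set0) (W := setT) (D := set0)
          (j := n + 'C(n, k))) => //.
- split; rewrite ?sub0set //; first by rewrite disjoints_subset sub0set.
  move=> e /ksubsetsP[_ ce].
  by rewrite setD0 ce inE.
- by rewrite cards0.
- by rewrite !cards0.
- by rewrite cardsT card_ord.
Qed.

Lemma ramsey_number_upper k n : 0 < k -> 2 < n ->
  ramsey_number k.+2 k.+3 3 n <= n ^ (2 * k.+1 * n ^ k).
Proof.
move=> k_gt0 n_gt2; have n_gt0 : 0 < n by apply: leq_trans n_gt2.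
apply: leq_trans (ramsey_number_le (ramsey_arrow_upper k n)) _.
have le_bin := bin_le_exp n k.
have le_n : n <= n ^ k by rewrite -{1}(expn1 n) leq_exp2l // ltnW.
have le_base : 'C(n, k) + 2 <= n ^ k.+1 by rewrite expnS; nia.
rewrite [2 * _]mulnC -mulnA expnM.
apply: (@leq_trans ((n ^ k.+1) ^ (n + 'C(n, k)))).
  by rewrite leq_exp2r // addn_gt0 n_gt0.
by rewrite leq_pexp2l ?expn_gt0 ?n_gt0 //; lia.
Qed.

Import Order.TTheory GRing.Theory Num.Theory.

Section DeterminedBy.
Variable E : finType.
Implicit Types (g h : {set E}) (P Q : {set E}) (A B : {set {set E}}).

Definition determined_by P A : Prop :=
  forall g h, g :&: P = h :&: P -> (g \in A) = (h \in A).

Lemma determined_byC P A : determined_by P A -> determined_by P (~: A).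
Proof. by move=> detA g h eqP; rewrite !in_setC (detA g h). Qed.

Lemma determined_byS P Q A : P \subset Q -> determined_by P A -> determined_by Q A.
Proof.
move=> /setIidPr sPQ detA g h eqQ; apply: detA.
by rewrite -sPQ !setIA eqQ.
Qed.

Lemma determined_by_bigcap (I : finType) (D : pred I) P (A : I -> {set {set E}}) :
  (forall i, D i -> determined_by P (A i)) ->
  determined_by P (\bigcap_(i | D i) A i).
Proof.
move=> detA g h eqP; apply/bigcapP/bigcapP => inA i Di.
  by rewrite -(detA i Di g h) // inA.
by rewrite (detA i Di g h) // inA.
Qed.

(* Overwriting [g] on [P] by a member of [A] forgets only [g :&: P]. *)
Lemma card_setI_determined_by P A B :
    determined_by P A -> determined_by (~: P) B -> A != set0 ->
  #|B| <= #|B :&: A| * 2 ^ #|P|.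
Proof.
move=> detA detB /set0Pn[h hA].
pose overwrite g := (g :\: P) :|: (h :&: P).
have overwriteI g : overwrite g :&: P = h :&: P.
  by apply/setP => e; rewrite !inE; case: (e \in P); rewrite ?andbF ?andbT.
have overwriteIC g : overwrite g :&: ~: P = g :&: ~: P.
  by apply/setP => e; rewrite !inE; case: (e \in P); rewrite ?andbF ?andbT ?orbF.
have split_inj : injective (fun g => (overwrite g, g :&: P)).
  move=> g g' [eqC eqP]; rewrite -(setID g P) -(setID g' P) eqP !setDE.
  by rewrite -(overwriteIC g) eqC overwriteIC.
rewrite -(card_imset B split_inj) -card_powerset -cardsX.
apply/subset_leq_card/subsetP => _ /imsetP[g gB ->].
rewrite !inE /= subsetIr andbT (detB _ g) // gB.
by rewrite (detA _ h).
Qed.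

End DeterminedBy.

Local Open Scope ring_scope.

(* The probability that [k] independent fair bits do not all take prescribed values. *)
Definition miss_prob (R : realFieldType) k : R := 1 - (2 ^+ k)^-1.

Section MissProbability.
Variable R : realFieldType.

Lemma miss_prob_itv k : (0 < k)%N -> 0 < miss_prob R k < 1.
Proof.
move=> k_gt0; rewrite subr_gt0 invf_lt1 ?exprn_gt0 // exprn_egt1 ?ltr1n -?lt0n //.
by rewrite k_gt0 ltrBlDr ltrDl invr_gt0 exprn_gt0.
Qed.

Lemma miss_prob_ge0 k : 0 <= miss_prob R k.
Proof. by rewrite subr_ge0 invf_le1 ?exprn_gt0 // exprn_ege1 // ler1n. Qed.

Variable E : finType.
Implicit Types (A B : {set {set E}}).

Lemma card_setD_determined_by (P : {set E}) A B :
    determined_by P A -> determined_by (~: P) B -> A != set0 ->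
  #|B :\: A|%:R <= miss_prob R #|P| * #|B|%:R.
Proof.
move=> detA detB A0; have := card_setI_determined_by detA detB A0.
rewrite -(ler_nat R) natrM natrX -ler_pdivrMr ?exprn_gt0 // => leI.
rewrite -(cardsID A B) in leI *.
by rewrite natrD in leI *; rewrite mulrBl mul1r; lra.
Qed.

Lemma card_bigcap_setC_determined_by (I : finType) k (F : {set I})
    (P : I -> {set E}) (A : I -> {set {set E}}) :
    (forall i, determined_by (P i) (A i)) -> (forall i, A i != set0) ->
    {in F, forall i, #|P i| = k} ->
    {in F &, forall i j, i != j -> [disjoint P i & P j]} ->
  #|\bigcap_(i in F) ~: A i|%:R <= miss_prob R k ^+ #|F| * #|{set E}|%:R.
Proof.
move=> detA A0; have [m] := ubnP #|F|; elim: m F => // m IH F ltFm cP dP.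
have [-> | [i iF]] := set_0Vmem F.
  by rewrite big_set0 cards0 mul1r cardsT.
rewrite (big_setD1 i iF) /= setIC -setDE (cardsD1 i F) iF exprS -mulrA.
set B := \bigcap_(j in _) _.
have sF j : j \in F :\ i -> j \in F by case/setD1P.
have detB : determined_by (~: P i) B.
  apply: determined_by_bigcap => j /[dup] /setD1P[ji _] /sF jF.
  apply/determined_byC/(determined_byS _ (detA j)).
  by rewrite -disjoints_subset dP.
apply: le_trans (card_setD_determined_by (detA i) detB (A0 i)) _.
rewrite cP // ler_wpM2l ?miss_prob_ge0 //; apply: IH.
- by have := cardsD1 i F; rewrite iF; lia.
- by move=> j /sF; apply: cP.
- by move=> j l /sF jF /sF lF; apply: dP.
Qed.

End MissProbability.

Section FacetDisjoint.
Variable X : finType.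
Implicit Types (S T : {set X}) (F : {set {set X}}).

Definition facet_disjoint F : Prop :=
  {in F &, forall T T', T != T' -> [disjoint facets T & facets T']}.

Lemma label_sum_fiber_facet_disjoint (M : finZmodType) (lab : X -> M) S k c :
    {in S &, injective lab} ->
  facet_disjoint [set T in ksubsets k S | \sum_(x in T) lab x == c].
Proof.
move=> inj_lab T T' /setIdP[/ksubsetsP[sT _] /eqP sumT].
case/setIdP=> /ksubsetsP[sT' _] /eqP sumT'.
apply: contraNT => /pred0Pn[_ /andP[/imsetP[x xT ->] /imsetP[y yT' eqD]]].
have /inj_lab eqxy : lab x = lab y.
  apply: (addIr (\sum_(z in T :\ x) lab z)).
  by rewrite -big_setD1 // sumT eqD -big_setD1.
by rewrite -(setD1K xT) eqD (eqxy (subsetP sT x xT) (subsetP sT' y yT')) setD1K.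
Qed.

(* The Graham-Sloane construction: label [S] by residues modulo [#|S|] and fix the
   sum of the labels, so that a facet determines the missing point. *)
Lemma exists_facet_disjoint S k : (0 < #|S|)%N ->
  exists F, [/\ F \subset ksubsets k S, facet_disjoint F &
    ('C(#|S|, k) <= #|S| * #|F|)%N].
Proof.
case cS: #|S| => [//|n] _; pose lab x : 'I_n.+1 := inord (index x (enum S)).
have lt_index x : x \in S -> (index x (enum S) < n.+1)%N.
  by rewrite -cS cardE index_mem mem_enum.
have inj_lab : {in S &, injective lab}.
  move=> x y xS yS /(congr1 val) /=; rewrite !inordK ?lt_index // => eq_index.
  by apply: (@index_inj _ x (enum S)); rewrite ?mem_enum.
have [c large] := exists_large_fiber ord0 (ksubsets k S) (fun T => \sum_(x in T) lab x).
exists [set T in ksubsets k S | \sum_(x in T) lab x == c]; split.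
- by apply/subsetP => T /setIdP[].
- exact: label_sum_fiber_facet_disjoint.
- by rewrite card_ksubsets card_ord cS in large.
Qed.

End FacetDisjoint.

(* The sets belonging to [g] are positively oriented with respect to the order of
   [X]; [T] is coherent when all its facets are oriented as in the boundary of [T],
   or all as in the boundary of [- T]. *)
Section Coherent.
Variables (d : Order.disp_t) (X : finOrderType d).
Implicit Types (T V : {set X}) (F g : {set {set X}}).

Definition position T v := #|[set u in T | (u < v)%O]|.

Definition boundary_signed g T s :=
  [forall v in T, (T :\ v \in g) == s (+) odd (position T v)].

Definition coherent g T := [exists s, boundary_signed g T s].

Lemma position_setD1 V u v : u \in V ->
  position V v = ((u < v)%O + position (V :\ u) v)%N.
Proof.
move=> uV; rewrite /position (cardsD1 u) inE uV /=; congr (_ + _)%N.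
by apply: eq_card => w; rewrite !inE andbA.
Qed.

Lemma odd_position_setD1 V u v : u \in V -> v \in V -> u != v ->
  odd (position (V :\ u) v) (+) odd (position (V :\ v) u)
    = ~~ (odd (position V u) (+) odd (position V v)).
Proof.
move=> uV vV nuv; rewrite (position_setD1 v uV) (position_setD1 u vV) !oddD !oddb.
by case: ltgtP nuv => // _ _; do 2 case: odd.
Qed.

Lemma boundary_signed_setD1_pair g V u v s s' : u \in V -> v \in V -> u != v ->
    boundary_signed g (V :\ u) s -> boundary_signed g (V :\ v) s' ->
  s (+) s' = ~~ (odd (position V u) (+) odd (position V v)).
Proof.
move=> uV vV nuv /forall_inP/(_ v) signu /forall_inP/(_ u) signv.
rewrite -odd_position_setD1 //.
have {signu} : (V :\ u :\ v \in g) == s (+) odd (position (V :\ u) v).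
  by apply: signu; rewrite !inE eq_sym nuv.
have {signv} : (V :\ v :\ u \in g) == s' (+) odd (position (V :\ v) u).
  by apply: signv; rewrite !inE nuv.
rewrite !setDDl [[set v] :|: _]setUC => /eqP-> /eqP.
by do 2 case: odd; case: s; case: s'.
Qed.

(* If three of these sets were coherent, the three instances of
   [boundary_signed_setD1_pair] would add up to [0 = 1] modulo 2. *)
Lemma coherent_setD1_le2 g V : (#|[set v in V | coherent g (V :\ v)]| <= 2)%N.
Proof.
rewrite leqNgt; apply/card_gt2P => -[u [v [w [[]]]]].
move=> /setIdP[uV /existsP[a au]] /setIdP[vV /existsP[b bv]] /setIdP[wV /existsP[c cw]].
move=> [uv vw wu].
have := boundary_signed_setD1_pair uV vV uv au bv.
have := boundary_signed_setD1_pair vV wV vw bv cw.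
have := boundary_signed_setD1_pair wV uV wu cw au.
by case: a {au}; case: b {bv}; case: c {cw}; do 3 case: odd.
Qed.

Lemma coherent_determined_by T : determined_by (facets T) [set g | coherent g T].
Proof.
move=> g h eq_facets; rewrite !inE; apply: eq_existsb => s.
apply: eq_forallb_in => v vT; have /setP/(_ (T :\ v)) := eq_facets.
by rewrite !in_setI (imset_f (fun w => T :\ w) vT) !andbT => ->.
Qed.

Lemma coherent_neq0 T : [set g | coherent g T] != set0.
Proof.
apply/set0Pn; exists [set T :\ v | v in T & odd (position T v)].
rewrite inE; apply/existsP; exists false; apply/forall_inP => v vT.
apply/eqP; apply/imsetP/idP => [[w /setIdP[wT oddw] /setD1_inj->] // | oddv].
by exists v; rewrite // inE vT.
Qed.

Definition incoherent_on F : {set {set {set X}}} :=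
  \bigcap_(T in F) ~: [set g | coherent g T].

Lemma card_incoherent_on (R : realFieldType) k F :
    {in F, forall T, #|T| = k} -> facet_disjoint F ->
  #|incoherent_on F|%:R <= miss_prob R k ^+ #|F| * #|{set {set X}}|%:R.
Proof.
move=> cF dF; apply: (@card_bigcap_setC_determined_by R _ _ k F (@facets X)) => //.
- exact: coherent_determined_by.
- exact: coherent_neq0.
- by move=> T TF; rewrite card_facets cF.
Qed.

End Coherent.

Definition coherent_coloring N (g : {set {set 'I_N}}) : coloring N :=
  [ffun T => coherent g T].

Lemma coherent_coloring_no_red_spot k N (g : {set {set 'I_N}}) :
  ~~ has_red_spot k k.+1 3 (coherent_coloring g).
Proof.
apply/has_red_spotP => -[V _]; rewrite leqNgt ltnS => /negP; apply.
rewrite -[X in (X <= _)%N](eq_card (A := [set v in V | coherent g (V :\ v)])).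
  exact: coherent_setD1_le2.
by move=> v; rewrite !inE ffunE.
Qed.

Lemma ramsey_arrow_incoherent_cover k n N : ramsey_arrow k k.+1 3 n N ->
  (#|{set {set 'I_N}}| <=
     \sum_(S : {set 'I_N} | #|S| == n) #|incoherent_on (ksubsets k S)|)%N.
Proof.
move=> /forallP arr; apply: leq_trans (leq_card_bigcup _ _).
rewrite -cardsT; apply/subset_leq_card/subsetP => g _; apply/bigcupP.
have := arr (coherent_coloring g).
rewrite (negPf (coherent_coloring_no_red_spot _ _)) orbF.
move=> /existsP[S /andP[cS /forall_inP blue]]; exists S => //.
apply/bigcapP => T; rewrite !inE => Tk.
by have := blue T Tk; rewrite ffunE.
Qed.

Section RealEstimates.
Variable R : realType.

Lemma card_incoherent_on_ksubsets (d : Order.disp_t) (X : finOrderType d) k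
    (S : {set X}) : (0 < k <= #|S|)%N ->
  #|incoherent_on (ksubsets k S)|%:R <=
    miss_prob R k `^ (#|S|%:R ^+ k.-1 / k%:R ^+ k) * #|{set {set X}}|%:R.
Proof.
move=> /andP[k_gt0 le_kS]; have S_gt0 : (0 < #|S|)%N by apply: leq_trans le_kS.
have [F [sF dF leF]] := exists_facet_disjoint k S_gt0.
have q_itv : 0 < miss_prob R k <= 1.
  by have /andP[-> /ltW] := miss_prob_itv R k_gt0.
apply: (@le_trans _ _ #|incoherent_on F|%:R).
  rewrite ler_nat; apply/subset_leq_card/bigcapsP => T TF.
  exact/bigcap_inf/(subsetP sF).
have cF : {in F, forall T : {set X}, #|T| = k} by move=> T /(subsetP sF)/ksubsetsP[].
apply: le_trans (card_incoherent_on R cF dF) _; rewrite ler_wpM2r ?ler0n //.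
rewrite -powR_mulrn ?miss_prob_ge0 //; apply: (ger_powR q_itv).
rewrite ler_pdivrMr ?exprn_gt0 ?ltr0n // -!natrX -natrM ler_nat.
rewrite -(leq_pmul2l S_gt0) -expnS prednK // mulnA.
by apply: leq_trans (exp_le_bin le_kS) _; rewrite leq_mul2r leF orbT.
Qed.

Lemma ramsey_arrow_union_bound k n N : (0 < k <= n)%N -> ramsey_arrow k k.+1 3 n N ->
  1 <= N%:R ^+ n * miss_prob R k `^ (n%:R ^+ k.-1 / k%:R ^+ k).
Proof.
move=> k_itv arr; set p := _ `^ _.
have orientations_gt0 : 0 < #|{set {set 'I_N}}|%:R :> R.
  by rewrite ltr0n; apply/card_gt0P; exists set0.
rewrite -(ler_pM2r orientations_gt0) mul1r.
have := ramsey_arrow_incoherent_cover arr; rewrite -(ler_nat R) => /le_trans; apply.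
rewrite natr_sum; apply: (@le_trans _ _
  (\sum_(S : {set 'I_N} | #|S| == n) p * #|{set {set 'I_N}}|%:R)).
  by apply: ler_sum => S /eqP cS; rewrite /p -cS card_incoherent_on_ksubsets ?cS.
rewrite sumr_const -[X in X <= _]mulr_natl mulrA !ler_wpM2r ?powR_ge0 //.
by rewrite -natrX ler_nat -cardsE card_draws card_ord; apply: bin_le_exp.
Qed.

Lemma ramsey_arrow_lower k n N : (k.+2 <= n)%N -> ramsey_arrow k.+2 k.+3 3 n N ->
  miss_prob R k.+2 `^ (- (n%:R ^+ k / k.+2%:R ^+ k.+2)) <= N%:R.
Proof.
move=> le_kn arr; have n_gt0 : (0 < n)%N by apply: leq_trans le_kn.
have := @ramsey_arrow_union_bound k.+2 n N le_kn arr.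
have q_gt0 : 0 < miss_prob R k.+2 by have /andP[] := miss_prob_itv R (ltn0Sn k.+1).
set q := miss_prob R _ in q_gt0 *; set y := _ / _ => union_bound.
rewrite -(ler_pXn2r n_gt0) ?nnegrE ?powR_ge0 ?ler0n //.
rewrite -(powR_mulrn n (powR_ge0 _ _)) -powRrM mulNr mulrAC -exprSr powRN.
by rewrite -[leLHS]mul1r ler_pdivrMr ?powR_gt0.
Qed.

Lemma ramsey_number_lower k n : (k.+2 <= n)%N ->
  miss_prob R k.+2 `^ (- (n%:R ^+ k / k.+2%:R ^+ k.+2)) <=
    (ramsey_number k.+2 k.+3 3 n)%:R.
Proof.
by move=> le_kn; apply/ramsey_arrow_lower/(ramsey_arrow_number (ramsey_arrow_upper k n)).
Qed.

Lemma powR_change_base (a b x : R) : 0 < a -> 0 < b -> b != 1 ->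
  a `^ x = b `^ (ln a / ln b * x).
Proof.
move=> a_gt0 b_gt0 b_neq1; rewrite /powR !gt_eqF // mulrAC divfK 1?mulrC //.
by rewrite ln_eq0.
Qed.

End RealEstimates.

Theorem theorem1p4 (R : realType) (k : nat) (hk : (3 <= k)%N) :
  exists c c' : R,
    [/\ 0 < c, 0 < c' &
      forall n : nat, (k.+1 < n)%N ->
        2 `^ (c * n%:R ^+ (k - 2)) <= (ramsey_number k k.+1 3 n)%:R :> R
        /\ (ramsey_number k k.+1 3 n)%:R <= 2 `^ (c' * n%:R ^+ (k - 2) * ln n%:R) :> R].
Proof.
case: k hk => [|[|k]] // k_gt0; rewrite subn2 /=.
have ln2_gt0 : 0 < ln 2 :> R by rewrite ln_gt0 // ltr1n.
have to_base2 (a x : R) : 0 < a -> a `^ x = 2 `^ (ln a / ln 2 * x).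
  by move=> a_gt0; rewrite -powR_change_base // pnatr_eq1.
have q_itv := miss_prob_itv R (ltn0Sn k.+1); have /andP[q_gt0 _] := q_itv.
exists (- ln (miss_prob R k.+2) / ln 2 / k.+2%:R ^+ k.+2), (2 * k.+1%:R / ln 2).
split=> [||n lt_kn].
- by rewrite !divr_gt0 ?exprn_gt0 ?ltr0n // oppr_gt0 ln_lt0.
- by rewrite divr_gt0 // mulr_gt0 // ltr0n.
have n_gt2 : (2 < n)%N by apply: leq_trans lt_kn.
have n_gt0 : 0 < n%:R :> R by rewrite ltr0n (ltn_trans _ n_gt2).
split.
  apply: le_trans (ramsey_number_lower R (ltnW (ltnW lt_kn))).
  by rewrite [leRHS]to_base2 // le_eqVlt; apply/predU1l; congr (2 `^ _); ring.
have := ramsey_number_upper k_gt0 n_gt2; rewrite -(ler_nat R) => /le_trans; apply.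
rewrite natrX -[leLHS]powR_mulrn ?ler0n // [leLHS]to_base2 // !natrM natrX.
by rewrite le_eqVlt; apply/predU1l; congr (2 `^ _); ring.
Qed.
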